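(* Let $I:[0,1]^2\to[0,1]$ be a fuzzy implication. Then the following are equivalent: (1) $I$ is a strict $(\mathcal{GO},N)$-implication with $\mathcal{GO}$ satisfying, for all $x,y\in[0,1]$, that $\mathcal{GO}(x,y)=0$ implies $xy=0$ and that $\mathcal{GO}(x,y)=1$ implies $xy=1$; that is, there exist such a bivariate general overlap function $\mathcal{GO}$ and a strict fuzzy negation $N$ with $I(x,y)=N(\mathcal{GO}(x,N(y)))$ for all $x,y\in[0,1]$; (2) $I$ is a strict $(G,N)$-implication; that is, there exist a grouping function $G$ and a strict fuzzy negation $N$ with $I(x,y)=G(N(x),y)$ for all $x,y\in[0,1]$.
   Context: A fuzzy negation is a map $N:[0,1]\to[0,1]$ with $N(0)=1$, $N(1)=0$ and $N(x)\le N(y)$ whenever $y\le x$. It is strict if it is continuous and $N(x)<N(y)$ whenever $y<x$. A bivariate general overlap function is a function $\mathcal{GO}:[0,1]^2\to[0,1]$ such that for all $x,y\in[0,1]$: (1) $\mathcal{GO}(x,y)=\mathcal{GO}(y,x)$; (2) if $xy=0$ then $\mathcal{GO}(x,y)=0$; (3) if $xy=1$ then $\mathcal{GO}(x,y)=1$; (4) $\mathcal{GO}$ is increasing (in the non-strict sense) in each variable; (5) $\mathcal{GO}$ is continuous. A grouping function is a function $G:[0,1]^2\to[0,1]$ that is commutative, continuous, increasing (in the non-strict sense) in each variable, and satisfies $G(x,y)=0$ if and only if $x=y=0$, and $G(x,y)=1$ if and only if $x=1$ or $y=1$. A fuzzy implication is a function $I:[0,1]^2\to[0,1]$ such that for all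 $x,y,z\in[0,1]$: $x\le z$ implies $I(x,y)\ge I(z,y)$; $y\le z$ implies $I(x,y)\le I(x,z)$; $I(0,y)=1$; $I(x,1)=1$; $I(1,0)=0$. *)

(* Defs.v *)
From HB Require Import structures.
From mathcomp Require Import all_boot all_order all_algebra.
From mathcomp Require Import all_classical all_reals all_analysis.
Set Implicit Arguments.
Unset Strict Implicit.
Unset Printing Implicit Defensive.
Import Order.TTheory GRing.Theory Num.Theory.
Import numFieldNormedType.Exports.
Local Open Scope classical_set_scope.
Local Open Scope ring_scope.

(* A map [0,1] -> [0,1] (resp. [0,1]^2 -> [0,1]) is encoded as a function on R
   (resp. R x R) of which only the restriction to [0,1] (resp. [0,1]^2)
   matters: every condition below is relativized to arguments in [0,1], and
   continuity is that of the restriction, for the subspace topology. *)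

Definition maps_unit1 (R : realType) (f : R -> R) : Prop :=
  forall x : R, x \in `[0, 1] -> f x \in `[0, 1].

Definition maps_unit2 (R : realType) (f : R -> R -> R) : Prop :=
  forall x y : R, x \in `[0, 1] -> y \in `[0, 1] -> f x y \in `[0, 1].

Definition commutative_unit2 (R : realType) (f : R -> R -> R) : Prop :=
  forall x y : R, x \in `[0, 1] -> y \in `[0, 1] -> f x y = f y x.

Definition increasing_unit2 (R : realType) (f : R -> R -> R) : Prop :=
  forall x y z : R, x \in `[0, 1] -> y \in `[0, 1] -> z \in `[0, 1] ->
    (x <= z -> f x y <= f z y) /\ (y <= z -> f x y <= f x z).

Definition continuous_unit1 (R : realType) (f : R -> R) : Prop :=
  {within `[0, 1], continuous f}.

(* Joint continuity on the square. *)
Definition continuous_unit2 (R : realType) (f : R -> R -> R) : Prop :=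
  {within `[0, 1] `*` `[0, 1], continuous (fun p : R * R => f p.1 p.2)}.

Record fuzzy_negation (R : realType) (N : R -> R) : Prop := FuzzyNegation {
  fneg_maps : maps_unit1 N;
  fneg0 : N 0 = 1;
  fneg1 : N 1 = 0;
  fneg_le : forall x y : R, x \in `[0, 1] -> y \in `[0, 1] ->
    y <= x -> N x <= N y }.

Record strict_fuzzy_negation (R : realType) (N : R -> R) : Prop :=
  StrictFuzzyNegation {
    sfneg_neg : fuzzy_negation N;
    sfneg_continuous : continuous_unit1 N;
    sfneg_lt : forall x y : R, x \in `[0, 1] -> y \in `[0, 1] ->
      y < x -> N x < N y }.

Record general_overlap (R : realType) (GO : R -> R -> R) : Prop :=
  GeneralOverlap {
    go_maps : maps_unit2 GO;
    go_comm : commutative_unit2 GO;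
    go_eq0 : forall x y : R, x \in `[0, 1] -> y \in `[0, 1] ->
      x * y = 0 -> GO x y = 0;
    go_eq1 : forall x y : R, x \in `[0, 1] -> y \in `[0, 1] ->
      x * y = 1 -> GO x y = 1;
    go_increasing : increasing_unit2 GO;
    go_continuous : continuous_unit2 GO }.

Record grouping (R : realType) (G : R -> R -> R) : Prop := Grouping {
  grouping_maps : maps_unit2 G;
  grouping_comm : commutative_unit2 G;
  grouping_continuous : continuous_unit2 G;
  grouping_increasing : increasing_unit2 G;
  grouping_eq0 : forall x y : R, x \in `[0, 1] -> y \in `[0, 1] ->
    G x y = 0 <-> x = 0 /\ y = 0;
  grouping_eq1 : forall x y : R, x \in `[0, 1] -> y \in `[0, 1] ->
    G x y = 1 <-> x = 1 \/ y = 1 }.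

Record fuzzy_implication (R : realType) (I : R -> R -> R) : Prop :=
  FuzzyImplication {
    fimp_maps : maps_unit2 I;
    fimp_le_l : forall x y z : R,
      x \in `[0, 1] -> y \in `[0, 1] -> z \in `[0, 1] ->
      x <= z -> I z y <= I x y;
    fimp_le_r : forall x y z : R,
      x \in `[0, 1] -> y \in `[0, 1] -> z \in `[0, 1] ->
      y <= z -> I x y <= I x z;
    fimp0 : forall y : R, y \in `[0, 1] -> I 0 y = 1;
    fimpx1 : forall x : R, x \in `[0, 1] -> I x 1 = 1;
    fimp10 : I 1 0 = 0 }.

(* Main.v *)
Require Import Defs.
From HB Require Import structures.
From mathcomp Require Import all_boot all_order all_algebra.
From mathcomp Require Import all_classical all_reals all_analysis.
Import Order.TTheory GRing.Theory Num.Theory.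
Import numFieldNormedType.Exports.
Local Open Scope ring_scope.

(** Let [M] be the inverse of a strict negation [N]; it is again a strict
    negation ([strict_negation_inverse]).  For a binary operation [F] on the
    unit interval, the [N]-dual of [F] is [N (F (N x) (N y))].  Duality
    exchanges overlap functions without nontrivial zeros and ones with
    grouping functions ([grouping_dual]; [overlap_dual] with
    [dual_grouping_eq0] and [dual_grouping_eq1]): a strict negation is a
    decreasing homeomorphism exchanging [0] and [1], so symmetry, monotonicity
    and continuity are preserved while the conditions at [0] and at [1] are
    swapped.

    Both directions are then a change of variables, in which the negation has
    to change to its inverse because strict negations need not be involutive:
    the [N]-dual puts [N] on both arguments, so that [M] must cancel it on [x].
    If [I x y = N (GO x (N y))], write [x = N (M x)] to read [I x y] as the
    [N]-dual of [GO] at [(M x, y)]: a [(G,N)]-implication with negation [M].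
    If [I x y = G (N x) y], then [M (N t) = t] for [t = G (N x) y] and
    [y = N (M y)] give [I x y = M (F x (M y))] with [F] the [N]-dual of [G]. *)

Definition dual {R : realType} (N : R -> R) (F : R -> R -> R) (x y : R) : R :=
  N (F (N x) (N y)).

Lemma within_continuous_comp {X Y Z : topologicalType} {A : set X} {B : set Y}
    {f : X -> Y} {g : Y -> Z} :
  (forall x, A x -> B (f x)) ->
  {within A, continuous f}%classic -> {within B, continuous g}%classic ->
  {within A, continuous (g \o f)}%classic.
Proof.
move=> fAB /subspace_continuousP cf /subspace_continuousP cg.
apply/subspace_continuousP => x Ax.
apply: cvg_comp (cg _ (fAB _ Ax)) => U BU.
have : \forall y \near x, A y -> B (f y) -> U (f y) := cf _ Ax _ BU.
by apply: filterS => y Uy Ay; exact: Uy Ay (fAB _ Ay).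
Qed.

Lemma within_continuous_prodmap {X Y : topologicalType} {A : set X}
    {f : X -> Y} :
  {within A, continuous f}%classic ->
  {within (A `*` A), continuous (fun p : X * X => (f p.1, f p.2))}%classic.
Proof.
move=> cf; apply/subspace_continuousP => p [Ap1 Ap2].
have cfst : {within (A `*` A), continuous (f \o fst)}%classic.
  apply: within_continuous_comp cf; first by move=> ? [].
  by apply: continuous_subspaceT => q; exact: cvg_fst.
have csnd : {within (A `*` A), continuous (f \o snd)}%classic.
  apply: within_continuous_comp cf; first by move=> ? [].
  by apply: continuous_subspaceT => q; exact: cvg_snd.
move/subspace_continuousP: cfst => /(_ p) cfst.
move/subspace_continuousP: csnd => /(_ p) csnd.
by apply: cvg_pair; [exact: cfst | exact: csnd].
Qed.

Section StrictNegation.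
Context {R : realType} {N : R -> R} (hN : strict_fuzzy_negation N).

Lemma unit0 : (0 : R) \in `[0, 1]. Proof. by rewrite bound_itvE. Qed.
Lemma unit1 : (1 : R) \in `[0, 1]. Proof. by rewrite bound_itvE. Qed.

Let N0 : N 0 = 1 := fneg0 (sfneg_neg hN).
Let N1 : N 1 = 0 := fneg1 (sfneg_neg hN).
Let N_maps x : x \in `[0, 1] -> N x \in `[0, 1].
Proof. exact: (fneg_maps (sfneg_neg hN)). Qed.

Lemma strict_negation_mono : {in `[0, 1] &, {mono N : x y /~ x <= y}}.
Proof. by apply: le_nmono_in => x y ux uy; exact: (sfneg_lt hN). Qed.

Lemma strict_negation_inj : {in `[0, 1] &, injective N}.
Proof. exact: (dec_inj_in strict_negation_mono). Qed.

Lemma strict_negation_eq0 {x} : x \in `[0, 1] -> N x = 0 <-> x = 1.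
Proof.
move=> ux; split=> [|->//]; rewrite -N1.
by move/strict_negation_inj; apply => //; exact: unit1.
Qed.

Lemma strict_negation_eq1 {x} : x \in `[0, 1] -> N x = 1 <-> x = 0.
Proof.
move=> ux; split=> [|->//]; rewrite -N0.
by move/strict_negation_inj; apply => //; exact: unit0.
Qed.

(** Surjectivity is the intermediate value theorem; the inverse is continuous
    because a monotone surjection between segments has no room for a jump. *)
Lemma strict_negation_inverse :
  exists M : R -> R, [/\ strict_fuzzy_negation M,
    {in `[0, 1], cancel N M} & {in `[0, 1], cancel M N}].
Proof.
have surj y : exists x, y \in `[0, 1] -> x \in `[0, 1] /\ N x = y.
  have [uy|] := boolP (y \in `[0, 1]); last by exists 0.
  have [|x ux Nx] := @IVT R N 0 1 y ler01 (sfneg_continuous hN).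
    by rewrite N0 N1 (min_idPr ler01) (max_idPl ler01); rewrite in_itv in uy.
  by exists x.
have [M MP] := choice surj.
have uM y : y \in `[0, 1] -> M y \in `[0, 1] by move=> /MP[].
have MK : {in `[0, 1], cancel M N} by move=> y /MP[].
have NK : {in `[0, 1], cancel N M}.
  by move=> x ux; apply: strict_negation_inj; rewrite ?uM ?MK ?N_maps.
have Mmono : {in `[0, 1] &, {mono M : x y /~ x <= y}}.
  move=> x y ux uy; rewrite -[in RHS](MK x)// -[in RHS](MK y)//.
  by rewrite strict_negation_mono ?uM.
have M0 : M 0 = 1 by rewrite -N1 NK ?unit1.
have M1 : M 1 = 0 by rewrite -N0 NK ?unit0.
exists M; split => //; split; first split => //.
- by move=> x y ux uy; rewrite Mmono.
- apply: segment_dec_surj_continuous => //; rewrite M0 M1 => x /= ux.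
  by exists (N x); rewrite ?NK//=; exact: N_maps.
- by move=> x y ux uy; rewrite (leW_nmono_in Mmono).
Qed.

Context {F : R -> R -> R} (F_maps : maps_unit2 F).

Lemma dual_maps : maps_unit2 (dual N F).
Proof. by move=> x y ux uy; rewrite /dual N_maps ?F_maps ?N_maps. Qed.

Lemma dual_comm : commutative_unit2 F -> commutative_unit2 (dual N F).
Proof. by move=> FC x y ux uy; rewrite /dual FC ?N_maps. Qed.

Lemma dual_increasing : increasing_unit2 F -> increasing_unit2 (dual N F).
Proof.
move=> Fi x y z ux uy uz; split=> le_;
  rewrite strict_negation_mono ?F_maps ?N_maps//.
- by apply: (Fi _ _ _ _ _ _).1; rewrite ?N_maps ?strict_negation_mono.
- by apply: (Fi _ _ _ _ _ _).2; rewrite ?N_maps ?strict_negation_mono.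
Qed.

Lemma dual_continuous : continuous_unit2 F -> continuous_unit2 (dual N F).
Proof.
move=> Fc; have Nc := sfneg_continuous hN.
apply: (within_continuous_comp
  (f := fun p : R * R => F (N p.1) (N p.2)) _ _ Nc).
  by move=> p [/= u1 u2]; rewrite F_maps ?N_maps.
apply: (within_continuous_comp _ (within_continuous_prodmap Nc) Fc).
by move=> p [/= u1 u2]; split; exact: N_maps.
Qed.

End StrictNegation.

Lemma unit_mul_eq1 {R : realType} {x y : R} :
  x \in `[0, 1] -> y \in `[0, 1] -> x * y = 1 <-> x = 1 /\ y = 1.
Proof.
rewrite !in_itv /= => /andP[x0 x1] /andP[y0 y1].
split=> [xy|[-> ->]]; last by rewrite mulr1.
split; apply/eqP; rewrite eq_le ?x1 ?y1 -xy; [exact: ler_piMr|exact: ler_piMl].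
Qed.

Lemma mul_eq0 {R : realType} {x y : R} : x * y = 0 <-> x = 0 \/ y = 0.
Proof.
by split=> [/eqP|[]->]; rewrite ?mul0r ?mulr0// mulf_eq0 => /orP[]/eqP; auto.
Qed.

(** [N (GO (N x) (N y))] vanishes exactly when [GO] takes the value [1] at
    [(N x, N y)], which by hypothesis is the corner [(1, 1)], that is
    [x = y = 0]; likewise it equals [1] exactly when [(N x, N y)] lies on an
    axis, that is when [x] or [y] is [1]. *)
Lemma grouping_dual {R : realType} {N : R -> R} {GO : R -> R -> R} :
  strict_fuzzy_negation N -> general_overlap GO ->
  (forall x y : R, x \in `[0, 1] -> y \in `[0, 1] ->
     (GO x y = 0 -> x * y = 0) /\ (GO x y = 1 -> x * y = 1)) ->
  grouping (dual N GO).
Proof.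
move=> hN [GOm GOC GO0 GO1 GOi GOc] GOn.
have Nm := fneg_maps (sfneg_neg hN).
split.
- exact: dual_maps.
- exact: dual_comm.
- exact: dual_continuous.
- exact: dual_increasing.
- move=> x y ux uy; rewrite /dual (strict_negation_eq0 hN) ?GOm ?Nm//.
  rewrite -(strict_negation_eq1 hN (x := x))//.
  rewrite -(strict_negation_eq1 hN (x := y))//.
  rewrite -unit_mul_eq1 ?Nm//.
  by split=> [/(GOn _ _ (Nm _ ux) (Nm _ uy)).2//|]; apply: GO1; exact: Nm.
- move=> x y ux uy; rewrite /dual (strict_negation_eq1 hN) ?GOm ?Nm//.
  rewrite -(strict_negation_eq0 hN (x := x))//.
  rewrite -(strict_negation_eq0 hN (x := y))//.
  rewrite -mul_eq0.
  by split=> [/(GOn _ _ (Nm _ ux) (Nm _ uy)).1//|]; apply: GO0; exact: Nm.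
Qed.

Lemma dual_grouping_eq0 {R : realType} {N : R -> R} {G : R -> R -> R}
    {x y : R} :
  strict_fuzzy_negation N -> grouping G -> x \in `[0, 1] -> y \in `[0, 1] ->
  dual N G x y = 0 <-> x * y = 0.
Proof.
move=> hN [Gm _ _ _ _ G1] ux uy; have Nm := fneg_maps (sfneg_neg hN).
rewrite /dual (strict_negation_eq0 hN) ?Gm ?Nm// G1 ?Nm//.
by rewrite !(strict_negation_eq1 hN)// mul_eq0.
Qed.

Lemma dual_grouping_eq1 {R : realType} {N : R -> R} {G : R -> R -> R}
    {x y : R} :
  strict_fuzzy_negation N -> grouping G -> x \in `[0, 1] -> y \in `[0, 1] ->
  dual N G x y = 1 <-> x * y = 1.
Proof.
move=> hN [Gm _ _ _ G0 _] ux uy; have Nm := fneg_maps (sfneg_neg hN).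
rewrite /dual (strict_negation_eq1 hN) ?Gm ?Nm// G0 ?Nm//.
by rewrite !(strict_negation_eq0 hN)// unit_mul_eq1.
Qed.

Lemma overlap_dual {R : realType} {N : R -> R} {G : R -> R -> R} :
  strict_fuzzy_negation N -> grouping G -> general_overlap (dual N G).
Proof.
move=> hN hG; have [Gm GC Gc Gi _ _] := hG.
split.
- exact: dual_maps.
- exact: dual_comm.
- by move=> x y ux uy /(dual_grouping_eq0 hN hG ux uy).
- by move=> x y ux uy /(dual_grouping_eq1 hN hG ux uy).
- exact: dual_increasing.
- exact: dual_continuous.
Qed.

Theorem corollary4 (R : realType) (I : R -> R -> R)
    (hI : fuzzy_implication I) :
  (exists (GO : R -> R -> R) (N : R -> R),
     [/\ general_overlap GO,
         (forall x y : R, x \in `[0, 1] -> y \in `[0, 1] ->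
            (GO x y = 0 -> x * y = 0) /\ (GO x y = 1 -> x * y = 1)),
         strict_fuzzy_negation N
       & forall x y : R, x \in `[0, 1] -> y \in `[0, 1] ->
           I x y = N (GO x (N y))])
  <->
  (exists (G : R -> R -> R) (N : R -> R),
     [/\ grouping G,
         strict_fuzzy_negation N
       & forall x y : R, x \in `[0, 1] -> y \in `[0, 1] ->
           I x y = G (N x) y]).
Proof.
split=> [[GO [N [hGO GOn hN IE]]]|[G [N [hG hN IE]]]].
- have [M [hM _ MK]] := strict_negation_inverse hN.
  exists (dual N GO), M; split=> //; first exact: grouping_dual.
  by move=> x y ux uy; rewrite /dual MK ?IE.
- have [M [hM NK MK]] := strict_negation_inverse hN.
  have Nm := fneg_maps (sfneg_neg hN).
  exists (dual N G), M; split=> //; first exact: overlap_dual.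
    by move=> x y ux uy; split=> [/dual_grouping_eq0|/dual_grouping_eq1]; apply.
  by move=> x y ux uy; rewrite /dual (MK y)// NK ?IE// (grouping_maps hG) ?Nm.
Qed.
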